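(* Let $N\ge 1$ be an integer. Let $z(s),A(s),B(s),C(s)$, $s=0,1,\dots,N$, be complex numbers with $C(0)=A(N)=0$, let $\lambda_0,\dots,\lambda_N\in\mathbb{C}$, and for each $n=0,1,\dots,N$ let $P_n(x)\in\mathbb{C}[x]$ be a monic polynomial of degree exactly $n$. Assume that $$A(s)P_n(z(s+1))+B(s)P_n(z(s))+C(s)P_n(z(s-1))=\lambda_nP_n(z(s)),\qquad n,s=0,1,\dots,N$$ (where the terms with coefficients $C(0)$ and $A(N)$ are absent). Assume the nondegeneracy conditions: $A(s-1)C(s)\ne0$ for $s=1,\dots,N$; $z(i)\neq z(j)$ for $i\ne j$; and $\lambda_i\neq\lambda_j$ for $i\neq j$. Then $P_0,\dots,P_N$ are finite Askey-Wilson orthogonal polynomials (that is, Racah or $q$-Racah polynomials, including their special and limiting cases) with grid $z(0),\dots,z(N)$ and spectrum $\lambda_0,\dots,\lambda_N$.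
   Context: Finite Askey-Wilson orthogonal polynomials (Racah and $q$-Racah polynomials, together with all their special and limiting cases): in the uniform description of this class, monic polynomials $P_0,\dots,P_N$ with $\deg P_n=n$ are finite Askey-Wilson polynomials with grid $\theta_0,\dots,\theta_N$ and spectrum $\theta_0^*,\dots,\theta_N^*$ (here $\theta_s=z(s)$, $\theta^*_n=\lambda_n$) if $P_n(\theta_0)\neq0$ for all $n$ and there are nonzero complex numbers $\varphi_1,\dots,\varphi_N$ and $\phi_1,\dots,\phi_N$ such that $$\frac{P_n(x)}{P_n(\theta_0)}=\sum_{i=0}^{n}\frac{\prod_{k=0}^{i-1}(\theta_n^*-\theta_k^* )\ \prod_{k=0}^{i-1}(x-\theta_k)}{\varphi_1\varphi_2\cdots\varphi_i},\qquad n=0,1,\dots,N,$$ where: (1) the $\theta_i$ are pairwise distinct and the $\theta_i^*$ are pairwise distinct; (2) for $1\le i\le N$, with $\vartheta_i=\sum_{h=0}^{i-1}\frac{\theta_h-\theta_{N-h}}{\theta_0-\theta_N}$, $$\varphi_i=\phi_1\vartheta_i+(\theta_i^*-\theta_0^* )(\theta_{i-1}-\theta_N),\qquad \phi_i=\varphi_1\vartheta_i+(\theta_i^*-\theta_0^* )(\theta_{N-i+1}-\theta_0);$$ (3) the expressions $\frac{\theta_{i-2}-\theta_{i+1}}{\theta_{i-1}-\theta_i}$ and $\frac{\theta^*_{i-2}-\theta^*_{i+1}}{\theta^*_{i-1}-\theta^*_i}$ are equal and independent of $i$ for $2\le i\le N-1$. (In particular, by (3), the grid and the spectrum are of quadratic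 or $q$-quadratic type or the corresponding $q=-1$ type.) *)

(* Defs.v *)
From mathcomp Require Import all_boot all_order all_algebra.
From mathcomp Require Import reals complex.
Set Implicit Arguments.
Unset Strict Implicit.
Unset Printing Implicit Defensive.
Import Order.TTheory GRing.Theory Num.Theory.
Local Open Scope ring_scope.

(* A sequence indexed by 0, ..., N is given by a function on nat, of which      *)
(* only the values at arguments <= N are ever constrained.                      *)
Section FiniteAskeyWilson.
Variables (F : fieldType) (N : nat).

Definition pairwise_distinct (u : nat -> F) : Prop :=
  forall i j : nat, (i <= N)%N -> (j <= N)%N -> i != j -> u i != u j.

Definition monic_family (P : nat -> {poly F}) : Prop :=
  forall n : nat, (n <= N)%N -> P n \is monic /\ size (P n) = n.+1.

Definition vartheta (theta : nat -> F) (i : nat) : F :=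
  \sum_(0 <= h < i) (theta h - theta (N - h)%N) / (theta 0%N - theta N).

Definition step_ratio (u : nat -> F) (i : nat) : F :=
  (u (i - 2)%N - u i.+1) / (u (i - 1)%N - u i).

Definition aw_series (theta thetas varphi : nat -> F) (n : nat) : {poly F} :=
  \sum_(0 <= i < n.+1)
    ((\prod_(0 <= k < i) (thetas n - thetas k)) /
     (\prod_(1 <= j < i.+1) varphi j))
    *: \prod_(0 <= k < i) ('X - (theta k)%:P).

(* theta is the grid, thetas the spectrum; varphi and phi are the first and     *)
(* second split sequences, indexed by 1, ..., N.                                *)
Record aw_parameters (theta thetas varphi phi : nat -> F) : Prop := {
  aw_varphi_neq0 : forall i : nat, (1 <= i <= N)%N -> varphi i != 0;
  aw_phi_neq0 : forall i : nat, (1 <= i <= N)%N -> phi i != 0;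
  aw_grid_distinct : pairwise_distinct theta;
  aw_spectrum_distinct : pairwise_distinct thetas;
  aw_varphiE : forall i : nat, (1 <= i <= N)%N ->
    varphi i = phi 1%N * vartheta theta i
               + (thetas i - thetas 0%N) * (theta (i - 1)%N - theta N);
  aw_phiE : forall i : nat, (1 <= i <= N)%N ->
    phi i = varphi 1%N * vartheta theta i
            + (thetas i - thetas 0%N) * (theta (N - i + 1)%N - theta 0%N);
  aw_step_ratio : exists c : F, forall i : nat, (2 <= i <= N - 1)%N ->
    step_ratio theta i = c /\ step_ratio thetas i = c
}.

Definition finite_askey_wilson (theta thetas : nat -> F)
    (P : nat -> {poly F}) : Prop :=
  [/\ monic_family P,
      forall n : nat, (n <= N)%N -> (P n).[theta 0%N] != 0
    & exists varphi phi : nat -> F,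
        aw_parameters theta thetas varphi phi /\
        forall n : nat, (n <= N)%N ->
          ((P n).[theta 0%N])^-1 *: P n = aw_series theta thetas varphi n].

End FiniteAskeyWilson.

(* Main.v *)
Require Import Defs.
From mathcomp Require Import all_boot all_order all_algebra.
From mathcomp Require Import reals complex.
From mathcomp Require Import ring zify.

(** The operator L h (s) = A(s) h(s+1) + B(s) h(s) + C(s) h(s-1) on functions on
    the grid is triangular on polynomials: it does not raise degrees, and its
    diagonal entries are the eigenvalues lam (diff_op_poly).  Everything follows
    from playing this against the fact that L couples only adjacent points.

    The Newton polynomial tau_i vanishes at the first i points of the grid, so
    L tau_i vanishes at the first i - 1 of them; having degree at most i, it is
    lam_i tau_i + varphi_i tau_(i-1), with varphi_i an explicit multiple of
    A(i-1) (diff_op_newton).  Solving L P = lam_n P in the Newton basis gives the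
    series.  Reversing the grid exchanges A and C and preserves all hypotheses
    (bispectral_rev), and yields the second split sequence phi.

    Recurrences for grid and spectrum (grid_spectrum_recurrence): let X be the
    multiplication by z.  In X L X^2 - X^2 L X the diagonal cancels, so it equals
    a commutator [Y, L] with Y the multiplication by a function y on the grid,
    determined by y(s+1) - y(s) = z(s) z(s+1) (z(s) - z(s+1)).  Applied to the
    constant 1, the left side has degree at most 3, hence so has y as a
    polynomial in z, since L - lam_0 preserves every positive degree up to N.  For
    N >= 3 the coefficient of degree 3 of y is nonzero.  Dividing
    the equation for y by z(s) - z(s+1) gives a symmetric quadratic relation
    between neighbours of the grid, hence a three-term recurrence; comparing
    leading coefficients on x^n gives the recurrence of the spectrum, with the
    same coefficient b.  For N <= 2 any b will do.

    Formula for varphi (split_seq_formula): consecutive terms of varphi are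
    tied to the diagonal coefficient B (diagonal_coef).  Since B can be computed
    from L 1, L x, L x^2 (drift_moments), the difference D of the two sides satisfies
    D_s (z_s - z_(s+1)) + D_(s+1) (z_s - z_(s-1)) = e1 z_s + e0 for s = 0, ..., N,
    where z_(-1) and z_(N+1) continue the recurrence.  The formula holds at
    i = 1 and i = N (split_seq_first, split_seq_last), and both sides vanish at
    0 and N + 1, so the affine right side vanishes at z_0 and z_N; it is zero, and
    D vanishes step by step.  The formula for phi is the one for varphi on the
    reversed grid. *)

Set Implicit Arguments.
Unset Strict Implicit.
Unset Printing Implicit Defensive.
Import Order.TTheory GRing.Theory Num.Theory.
Local Open Scope ring_scope.

(** Used repeatedly to subtract multiples of known equations from the goal, until
    it becomes a polynomial identity. *)
Lemma lincomb (F : fieldType) (k a b X Y : F) :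
  a = b -> X - k * a = Y - k * b -> X = Y.
Proof. by move=> -> /addIr. Qed.
Arguments lincomb {F} k {a b X Y}.

(** * Newton polynomials and interpolation *)

Definition newton (F : fieldType) (z : nat -> F) (i : nat) : {poly F} :=
  \prod_(0 <= k < i) ('X - (z k)%:P).

Section NewtonBasis.
Variables (F : fieldType) (N : nat) (z : nat -> F).
Hypothesis z_inj : pairwise_distinct N z.

Lemma newtonS i : newton z i.+1 = newton z i * ('X - (z i)%:P).
Proof. by rewrite /newton big_nat_recr. Qed.

Lemma newton0 : newton z 0 = 1.
Proof. by rewrite /newton big_geq. Qed.

Lemma monic_newton i : newton z i \is monic.
Proof. exact: monic_prod_XsubC. Qed.

Lemma size_newton i : size (newton z i) = i.+1.
Proof. by rewrite /newton size_prod_XsubC size_iota subn0. Qed.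

Lemma hornerS_newton i x : (newton z i.+1).[x] = (newton z i).[x] * (x - z i).
Proof. by rewrite newtonS hornerM hornerXsubC. Qed.

Lemma newton_eq0 i s : (s < i)%N -> (newton z i).[z s] = 0.
Proof.
elim: i => // i IH; rewrite ltnS leq_eqVlt hornerS_newton => /orP[/eqP->|/IH->].
  by rewrite subrr mulr0.
by rewrite mul0r.
Qed.

Lemma newton_neq0 i s : (i <= s <= N)%N -> (newton z i).[z s] != 0.
Proof.
elim: i => [|i IH] H; first by rewrite newton0 hornerC oner_eq0.
rewrite hornerS_newton mulf_neq0 ?IH ?subr_eq0 ?z_inj //; lia.
Qed.

Lemma poly_eq_on_grid m (f g : {poly F}) :
    (m <= N.+1)%N -> (size f <= m)%N -> (size g <= m)%N ->
    (forall s, (s < m)%N -> f.[z s] = g.[z s]) ->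
  f = g.
Proof.
move=> mN sf sg fg; apply/eqP; rewrite -subr_eq0; apply/eqP.
apply: (@roots_geq_poly_eq0 _ _ [seq z s | s <- iota 0 m]).
- apply/allP => x /mapP[s]; rewrite mem_iota => /andP[_ sm] ->.
  by rewrite /root hornerD hornerN fg ?subrr.
- rewrite map_inj_in_uniq ?iota_uniq // => i j.
  rewrite !mem_iota => Hi Hj Hij; apply/eqP/idPn => /z_inj Hn.
  by move/eqP: Hij; apply/negP; apply: Hn; lia.
- rewrite size_map size_iota (leq_trans (size_polyD _ _)) //.
  by rewrite size_polyN geq_max sf.
Qed.

Lemma size_XmulB m (f g : {poly F}) :
    (size f <= m.+2)%N -> (size g <= m.+1)%N ->
  (size ('X * f - 'X^2 * g)%R <= m.+3)%N.
Proof.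
move=> sf sg; apply/leq_sizeP => j jm; rewrite coefB coefXM coefXnM.
rewrite !nth_default ?if_same ?subrr //.
  by apply: leq_trans sg _; lia.
by apply: leq_trans sf _; lia.
Qed.

Lemma interpolation (v : nat -> F) m : (m <= N.+1)%N ->
  exists2 y : {poly F}, (size y <= m)%N &
    forall s, (s < m)%N -> y.[z s] = v s.
Proof.
elim: m => [|m IH] mN; first by exists 0; rewrite ?size_poly0.
have [|y sy yv] := IH; first lia.
exists (y + ((v m - y.[z m]) / (newton z m).[z m]) *: newton z m).
  rewrite (leq_trans (size_polyD _ _)) // geq_max leqW //=.
  by rewrite (leq_trans (size_scale_leq _ _)) // size_newton.
move=> s; rewrite ltnS leq_eqVlt hornerD hornerZ => /orP[/eqP->|sm].
  by rewrite divfK ?newton_neq0 ?leqnn //; ring.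
by rewrite (newton_eq0 sm) mulr0 addr0 yv.
Qed.

End NewtonBasis.

(** * Sequences with a second-order recurrence *)

Section Recurrence.
Variables (F : fieldType) (b : F).

Definition recurrent (g : F) (u : nat -> F) : Prop :=
  forall i, u i - b * u i.+1 + u i.+2 = g.

Fixpoint recurrent_seq (g u0 u1 : F) (n : nat) : F :=
  if n is m.+1 then recurrent_seq g u1 (g + b * u1 - u0) m else u0.

Lemma recurrent_seqP g u0 u1 : recurrent g (recurrent_seq g u0 u1).
Proof.
move=> n; elim: n u0 u1 => [|n IH] u0 u1; last exact: IH.
by rewrite /=; ring.
Qed.

(** Continuing a finite sequence past its end spares all later identities
    their range conditions and their special cases at the boundary. *)
Lemma recurrent_extension N g (u : nat -> F) :
    (forall i, (i.+2 <= N)%N -> u i - b * u i.+1 + u i.+2 = g) ->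
  exists2 x, recurrent g x & forall i, (i <= N)%N -> x i = u i.
Proof.
move=> uP; exists (recurrent_seq g (u 0%N) (u 1%N)); first exact: recurrent_seqP.
move=> i; elim/ltn_ind: i => -[|[|i]] IH iN //.
have := recurrent_seqP g (u 0%N) (u 1%N) i.
rewrite (IH i) ?(IH i.+1) ?(ltnW iN) ?(ltnW (ltnW iN)) // -(uP i iN).
exact: addrI.
Qed.

(** A discrete Wronskian: when i increases by one, the left side increases by
    (x_(i+2) - x_(i+1)) (u_i + u_(i+2)) - u_(i+1) (x_(i+3) - x_i), in which the
    terms with b cancel because x and u share this coefficient. *)
Lemma cross_difference_const g d x u : recurrent g x -> recurrent d u ->
  exists k, forall i,
    u i * (x i.+1 - x i.+2) + u i.+1 * (x i.+1 - x i) = d * x i.+1 + k.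
Proof.
move=> xP uP.
exists (u 0%N * (x 1%N - x 2%N) + u 1%N * (x 1%N - x 0%N) - d * x 1%N).
elim=> [|i IH]; first by ring.
apply: (lincomb 1 IH); apply: (lincomb (x i.+2 - x i.+1) (uP i)).
apply: (lincomb (u i.+1) (xP i)); apply: (lincomb (- u i.+1) (xP i.+1)); ring.
Qed.

End Recurrence.

Section Vartheta.
Variables (F : fieldType) (N : nat) (z : nat -> F).

Lemma varthetaS i :
  vartheta N z i.+1 = vartheta N z i + (z i - z (N - i)%N) / (z 0%N - z N).
Proof. by rewrite /vartheta big_nat_recr. Qed.

Lemma vartheta0 : vartheta N z 0 = 0.
Proof. by rewrite /vartheta big_geq. Qed.

(** The summands are antisymmetric under h -> N - h. *)
Lemma vartheta_end : vartheta N z N.+1 = 0.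
Proof.
rewrite /vartheta -mulr_suml sumrB [X in _ - X]big_nat_rev /=.
rewrite (@eq_big_nat _ _ _ _ _ (fun i => z (N - (0 + N.+1 - i.+1))%N) z).
  by rewrite subrr mul0r.
by move=> i; rewrite ltnS add0n subSS => /andP[_ iN]; rewrite subKn.
Qed.

Lemma vartheta1 : z 0%N != z N -> vartheta N z 1 = 1.
Proof.
by move=> zN; rewrite varthetaS vartheta0 add0r subn0 divff // subr_eq0.
Qed.

Lemma varthetaN : z 0%N != z N -> vartheta N z N = 1.
Proof.
move=> zN; have := varthetaS N; rewrite vartheta_end subnn => e.
have nz : z 0%N - z N != 0 by rewrite subr_eq0.
by apply: (lincomb (-1) e); field.
Qed.

Lemma vartheta_rev i : (i <= N)%N ->
  vartheta N (fun s => z (N - s)%N) i = vartheta N z i.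
Proof.
move=> iN; rewrite /vartheta; apply: eq_big_nat => h /andP[_ hi].
rewrite subnn subn0 subKn; last by rewrite (leq_trans _ iN) // ltnW.
by rewrite -(opprB (z h)) -(opprB (z 0%N)) invrN mulrNN.
Qed.

(** The increments z_h - z_(N-h) solve the homogeneous recurrence, because
    the recurrence reads the same in both directions. *)
Lemma vartheta_recurrent b g :
    (forall i, (i.+2 <= N)%N -> z i - b * z i.+1 + z i.+2 = g) ->
  exists k, forall i, (i.+2 <= N.+1)%N ->
    vartheta N z i - b * vartheta N z i.+1 + vartheta N z i.+2 = k.
Proof.
move=> zP; exists (vartheta N z 0 - b * vartheta N z 1 + vartheta N z 2).
elim=> // i IH iN; rewrite -IH; last exact: ltnW.
have e : z (N - i.+2)%N - b * z (N - i.+1)%N + z (N - i)%N = g.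
  have -> : (N - i.+1 = (N - i.+2).+1)%N by lia.
  have -> : (N - i = (N - i.+2).+2)%N by lia.
  by apply: zP; lia.
rewrite !varthetaS; set D := (z 0%N - z N)^-1.
by apply: (lincomb (- D) e); apply: (lincomb D (zP i iN)); ring.
Qed.

End Vartheta.

(** * The difference operator *)

Section DifferenceOperator.
Variables (F : fieldType) (A B C : nat -> F).

(** At the ends of the grid the predecessor of 0 is 0 and the successor of N is
    off the grid; both values come with a zero coefficient. *)
Definition diff_op (h : nat -> F) (s : nat) : F :=
  A s * h s.+1 + B s * h s + C s * h s.-1.

Lemma diff_opD a b h1 h2 s :
  diff_op (fun t => a * h1 t + b * h2 t) s
  = a * diff_op h1 s + b * diff_op h2 s.
Proof. by rewrite /diff_op; ring. Qed.

Lemma eq_diff_op h1 h2 s : h1 =1 h2 -> diff_op h1 s = diff_op h2 s.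
Proof. by move=> e; rewrite /diff_op !e. Qed.
End DifferenceOperator.

(** The hypotheses of the theorem over any field, with the nonvanishing of A and
    C separated so that reversing the grid exchanges the two fields. *)
Record bispectral (F : fieldType) (N : nat) (z A B C lam : nat -> F)
    (P : nat -> {poly F}) : Prop := {
  bs_C0 : C 0%N = 0;
  bs_AN : A N = 0;
  bs_A_neq0 : forall s, (s < N)%N -> A s != 0;
  bs_C_neq0 : forall s, (s < N)%N -> C s.+1 != 0;
  bs_monic : monic_family N P;
  bs_eigen : forall n s, (n <= N)%N -> (s <= N)%N ->
    diff_op A B C (fun t => (P n).[z t]) s = lam n * (P n).[z s];
  bs_grid : pairwise_distinct N z;
  bs_spectrum : pairwise_distinct N lam
}.

(** * Triangularity and the split sequence *)

Section Bispectral.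
Variables (F : fieldType) (N : nat) (z A B C lam : nat -> F).
Variable P : nat -> {poly F}.
Hypothesis bs : bispectral N z A B C lam P.

Let L := diff_op A B C.
Let z_inj := bs_grid bs.

(** Triangularity of L: subtract a multiple of P_m, on which L is known, to
    lower the degree. *)
Lemma diff_op_poly m (f : {poly F}) : (m <= N)%N -> (size f <= m.+1)%N ->
  exists g : {poly F}, [/\ (size g <= m.+1)%N, g`_m = lam m * f`_m &
    forall s, (s <= N)%N -> L (fun t => f.[z t]) s = g.[z s]].
Proof.
elim: m f => [|m IH] f mN sf.
- have [mP sP] := bs_monic bs (leq0n N).
  have P0 : P 0%N = 1.
    have := monicP mP; have := size1_polyC (eq_leq sP) => ->.
    by rewrite lead_coefC => ->.
  exists (lam 0%N * f`_0)%:P; rewrite coefC size_polyC; split=> //.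
    by case: eqP.
  move=> s sN; have := bs_eigen bs (leq0n N) sN.
  rewrite (size1_polyC sf) coefC P0 /diff_op !hornerC /L /diff_op /= !hornerC.
  by move=> e; rewrite -[lam 0%N]mulr1 -e; ring.
have [mP sP] := bs_monic bs mN.
have Pm : (P m.+1)`_m.+1 = 1 by have := monicP mP; rewrite lead_coefE sP.
pose f' := f - f`_m.+1 *: P m.+1.
have sf' : (size f' <= m.+1)%N.
  apply/leq_sizeP => j; rewrite leq_eqVlt => /orP[/eqP<-|Hj].
    by rewrite coefB coefZ Pm mulr1 subrr.
  rewrite coefB coefZ (nth_default _ (leq_trans sf Hj)).
  rewrite (@nth_default _ _ (P m.+1) j) ?sP //.
  by rewrite mulr0 subrr.
have [|g [sg cg Hg]] := IH f' _ sf'; first exact: ltnW.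
exists (g + (lam m.+1 * f`_m.+1) *: P m.+1); split.
- rewrite (leq_trans (size_polyD _ _)) // geq_max leqW //=.
  by rewrite (leq_trans (size_scale_leq _ _)) // sP.
- by rewrite coefD coefZ Pm (nth_default _ sg) add0r mulr1.
move=> s sN; rewrite hornerD hornerZ -Hg //.
rewrite -mulrA (mulrCA (lam _)) -(bs_eigen bs mN sN) -[X in X + _]mul1r -diff_opD.
by apply: eq_diff_op => t; rewrite /f' hornerD hornerN hornerZ; ring.
Qed.

(** The equation at s determines h(s+1) from h(s) and h(s-1), as A(s) is nonzero. *)
Lemma eigenfunction_eq0 (mu : F) (h : nat -> F) :
    (forall s, (s <= N)%N -> L h s = mu * h s) -> h 0%N = 0 ->
  forall s, (s <= N)%N -> h s = 0.
Proof.
move=> Lh h0 s; elim/ltn_ind: s => -[|s] IH sN //.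
have := Lh s (ltnW sN); rewrite /L /diff_op (IH s) ?(IH s.-1) //; try lia.
rewrite !mulr0 !addr0 => /eqP; rewrite mulf_eq0 (negPf (bs_A_neq0 bs _)) //.
by move/eqP.
Qed.

(** The value at 0, together with the value 0 at N + 1 that comes from
    A(N) = 0, makes the identities below hold at both ends of the grid. *)
Definition split_seq (i : nat) : F :=
  if i is j.+1 then A j * (newton z j.+1).[z j.+1] / (newton z j).[z j] else 0.
Arguments split_seq : simpl never.

Lemma split_seq_end : split_seq N.+1 = 0.
Proof. by rewrite /split_seq (bs_AN bs) !mul0r. Qed.

Lemma split_seq_neq0 i : (1 <= i <= N)%N -> split_seq i != 0.
Proof.
case: i => // i iN; rewrite /split_seq !mulf_neq0 ?invr_neq0 ?(newton_neq0 z_inj) //.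
- exact: (bs_A_neq0 bs).
- lia.
- lia.
Qed.

(** Both sides have the same coefficient in degree i + 1, so it suffices to
    compare them at the first i + 1 points.  There the Newton polynomial of degree
    i + 1 vanishes, and L sees it only from the last of these points. *)
Lemma diff_op_newton i s : (i < N)%N -> (s <= N)%N ->
  L (fun t => (newton z i.+1).[z t]) s
  = lam i.+1 * (newton z i.+1).[z s] + split_seq i.+1 * (newton z i).[z s].
Proof.
move=> iN sN; have [g [sg cg Hg]] := @diff_op_poly i.+1 (newton z i.+1) iN
  (eq_leq (size_newton z i.+1)).
have c1 : (newton z i.+1)`_i.+1 = 1.
  by have := monicP (monic_newton z i.+1); rewrite lead_coefE size_newton.
rewrite c1 mulr1 in cg.
suff E : g - lam i.+1 *: newton z i.+1 = split_seq i.+1 *: newton z i.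
  by rewrite Hg // -hornerZ -hornerZ -hornerD -E addrC subrK.
apply: (poly_eq_on_grid z_inj (m := i.+1)) => //.
- exact: ltnW.
- apply/leq_sizeP => j; rewrite leq_eqVlt => /orP[/eqP<-|Hj].
    by rewrite coefB coefZ c1 cg mulr1 subrr.
  rewrite coefB coefZ (nth_default _ (leq_trans sg Hj)).
  by rewrite (@nth_default _ _ (newton z i.+1) j) ?size_newton // mulr0 subrr.
- by rewrite (leq_trans (size_scale_leq _ _)) // size_newton.
move=> t ti; rewrite hornerD hornerN !hornerZ (newton_eq0 _ ti) mulr0 subr0.
rewrite -Hg; last lia.
rewrite /L /diff_op (newton_eq0 _ ti) mulr0 addr0 (@newton_eq0 _ z i.+1 t.-1); last lia.
rewrite mulr0 addr0; move: ti; rewrite ltnS leq_eqVlt => /orP[/eqP->|ti].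
  by rewrite /split_seq divfK // (newton_neq0 z_inj) // leqnn ltnW.
by rewrite (newton_eq0 _ ti) newton_eq0 // !mulr0.
Qed.

(** This is L 1 = lam_0. *)
Lemma diff_op_1 s : (s <= N)%N -> A s + B s + C s = lam 0%N.
Proof.
move=> sN; have [g [sg cg /(_ s sN)]] :=
  @diff_op_poly 0 1 (leq0n N) (eq_leq (size_poly1 F)).
rewrite /L /diff_op !hornerC !mulr1 => ->.
by rewrite (size1_polyC sg) hornerC cg coef1 mulr1.
Qed.

(** * The polynomials as Newton series *)

(** An eigenfunction vanishing at z_0 vanishes on the whole grid, which has more
    points than P_n can have roots. *)
Lemma monic_value_neq0 n : (n <= N)%N -> (P n).[z 0%N] != 0.
Proof.
move=> nN; have [mP sP] := bs_monic bs nN.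
apply/eqP => P0; have := monic_neq0 mP; apply/negP; rewrite negbK; apply/eqP.
apply: (poly_eq_on_grid z_inj (m := N.+1)) => //; rewrite ?sP ?size_poly0 //.
move=> s; rewrite ltnS horner0.
by apply: (@eigenfunction_eq0 (lam n) (fun t => (P n).[z t])) => // t tN;
  apply: (bs_eigen bs).
Qed.

(** The denominators turn L into a shift on the coefficients: the term that L
    sends down from one Newton polynomial completes the eigenvalue of the one
    below. *)
Lemma series_eigen n s : (n <= N)%N -> (s <= N)%N ->
  L (fun t => (aw_series z lam split_seq n).[z t]) s
  = lam n * (aw_series z lam split_seq n).[z s].
Proof.
move=> nN sN.
pose c i := (\prod_(0 <= k < i) (lam n - lam k)) / (\prod_(1 <= j < i.+1) split_seq j).
pose Q m := \sum_(0 <= i < m.+1) c i *: newton z i.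
have c0 : c 0%N = 1 by rewrite /c !big_geq // divr1.
have cS i : (i < N)%N -> c i.+1 * split_seq i.+1 = c i * (lam n - lam i).
  move=> iN; rewrite /c big_nat_recr //= [in X in _ / X]big_nat_recr //=.
  by rewrite invfM mulrA mulfVK ?split_seq_neq0 //; ring.
have QS m : Q m.+1 = Q m + c m.+1 *: newton z m.+1 by rewrite /Q big_nat_recr.
(* the truncations of the series are eigenfunctions up to a boundary term *)
have LQ m : (m <= N)%N -> L (fun t => (Q m).[z t]) s
    = lam n * (Q m).[z s] - (lam n - lam m) * c m * (newton z m).[z s].
  elim: m => [|m IH] mN.
    rewrite /Q big_nat1 c0 newton0 scale1r !hornerC.
    rewrite /L /diff_op !hornerC -(diff_op_1 sN); ring.
  have E t : (Q m.+1).[z t] = 1 * (Q m).[z t] + c m.+1 * (newton z m.+1).[z t].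
    by rewrite QS hornerD hornerZ mul1r.
  rewrite /L (eq_diff_op _ _ _ _ E) diff_opD -/L IH ?(ltnW mN) // diff_op_newton //.
  by rewrite E [c m.+1 * (_ + _)]mulrDr [c m.+1 * (split_seq _ * _)]mulrA cS //; ring.
have := LQ n nN; rewrite subrr !mul0r subr0; exact.
Qed.

(** Two eigenfunctions for the same eigenvalue, both equal to 1 at z_0. *)
Lemma series_expansion n : (n <= N)%N ->
  ((P n).[z 0%N])^-1 *: P n = aw_series z lam split_seq n.
Proof.
move=> nN; have Pn0 := monic_value_neq0 nN.
set p := ((P n).[z 0%N])^-1; set S := aw_series _ _ _ _.
have sS : (size S <= N.+1)%N.
  apply: (leq_trans (size_sum _ _ _)); apply/bigmax_leqP_seq => i.
  rewrite mem_index_iota => /andP[_ Hi] _.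
  by rewrite (leq_trans (size_scale_leq _ _)) // size_newton (leq_trans Hi).
apply: (poly_eq_on_grid z_inj (m := N.+1)) => //.
  by rewrite (leq_trans (size_scale_leq _ _)) // (bs_monic bs nN).2.
move=> s sN; apply/eqP; rewrite -subr_eq0; apply/eqP; move: s sN.
pose h t := p * (P n).[z t] + -1 * S.[z t].
have S0 : S.[z 0%N] = 1.
  rewrite /S /aw_series big_nat_recl // big_geq // big_geq // big_geq //.
  rewrite hornerD horner_sum divr1 scale1r hornerC.
  rewrite big1_seq ?addr0 // => i _; rewrite hornerZ.
  by rewrite (@newton_eq0 _ z i.+1 0) ?mulr0.
suff H : forall s, (s <= N)%N -> h s = 0.
  by move=> s sN; rewrite hornerZ -(H s sN) /h mulN1r.
apply: (@eigenfunction_eq0 (lam n)) => [s sN|]; last first.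
  by rewrite /h S0 mulVf // mulr1 subrr.
by rewrite /L diff_opD (bs_eigen bs nN sN) -/L series_eigen // /h; ring.
Qed.

(** L applied to the Newton polynomial of degree s and evaluated at the point s.
    The sequence x is the grid shifted by one, so that x_0 and x_(N+2) stand for
    points before and after the grid.  These may be chosen freely, since each occurs
    only in a factor common to both sides: split_seq vanishes at 0 and N + 1. *)
Lemma diagonal_coef (x : nat -> F) s :
    (forall i, (i <= N)%N -> x i.+1 = z i) -> (s <= N)%N ->
  (B s - lam s) * ((x s.+1 - x s) * (x s.+1 - x s.+2))
  = split_seq s * (x s.+1 - x s.+2) + split_seq s.+1 * (x s.+1 - x s).
Proof.
move=> xz sN.
have up : A s * (newton z s).[z s.+1] * (x s.+1 - x s.+2)
          = - (split_seq s.+1 * (newton z s).[z s]).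
  have ns : (newton z s).[z s] != 0 by rewrite (newton_neq0 z_inj) // leqnn.
  move: (sN); rewrite leq_eqVlt => /orP[/eqP->|sN'].
    by rewrite (bs_AN bs) split_seq_end !mul0r oppr0.
  by rewrite /split_seq divfK // hornerS_newton !xz //; ring.
case: s sN up => [|s] sN up.
  move: up; rewrite newton0 !hornerC => up.
  apply: (lincomb (x 0%N - x 1%N) up).
  by rewrite -(diff_op_1 sN) (bs_C0 bs) /split_seq -/(split_seq 1); ring.
have ns : (newton z s).[z s.+1] != 0.
  by rewrite (newton_neq0 z_inj) // leqnSn.
have := diff_op_newton sN sN; rewrite /L /diff_op (@newton_eq0 _ z s.+1 s) //.
move=> lo; apply: (mulIf ns); move: lo up.
rewrite !hornerS_newton -(xz s.+1) // -(xz s) ?(ltnW sN) // => lo up.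
apply: (lincomb (x s.+2 - x s.+3) lo); apply: (lincomb (-1) up); ring.
Qed.

(** * The recurrences of the grid and of the spectrum *)

(** This is X L X^2 - X^2 L X = [Y, L], with X and Y the multiplications by z
    and y.  The diagonal of L drops out of both sides, and the hypothesis on y is
    the equality of the coefficients that couple neighbours. *)
Lemma commutator_identity (y : nat -> F) (h : nat -> F) s :
    (forall t, (t < N)%N -> y t.+1 - y t = z t * z t.+1 * (z t - z t.+1)) ->
    (s <= N)%N ->
  z s * L (fun t => z t ^+ 2 * h t) s - z s ^+ 2 * L (fun t => z t * h t) s
  = y s * L h s - L (fun t => y t * h t) s.
Proof.
move=> yE sN; rewrite /L /diff_op.
have up : A s * h s.+1 * (y s.+1 - y s) =
          A s * h s.+1 * (z s * z s.+1 * (z s - z s.+1)).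
  move: (sN); rewrite leq_eqVlt => /orP[/eqP->|/yE->//].
  by rewrite (bs_AN bs) !mul0r.
have lo : C s * h s.-1 * (y s - y s.-1) =
          C s * h s.-1 * (z s.-1 * z s * (z s.-1 - z s)).
  by case: s sN {up} => [|s] sN; [rewrite (bs_C0 bs) !mul0r | rewrite yE].
by apply: (lincomb 1 up); apply: (lincomb (-1) lo); ring.
Qed.

(** If the degree d of the interpolating y exceeded 3, then the identity applied
    to 1 would read (lam_0 - L) y = polynomial of degree at most 3, although the
    coefficient of x^d on the left is (lam_0 - lam_d) y_d. *)
Lemma cubic_commutator : exists2 y : {poly F}, (size y <= 4)%N &
  forall t, (t < N)%N -> y.[z t.+1] - y.[z t] = z t * z t.+1 * (z t - z t.+1).
Proof.
pose v s := \sum_(0 <= k < s) z k * z k.+1 * (z k - z k.+1).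
have [y sy yv] := interpolation z_inj v (leqnn N.+1).
have yE t : (t < N)%N -> y.[z t.+1] - y.[z t] = z t * z t.+1 * (z t - z t.+1).
  move=> tN; rewrite !yv //; last by rewrite ltnW.
  rewrite /v big_nat_recr //=; ring.
exists y => //; rewrite leqNgt; apply/negP => y4.
pose d := (size y).-1.
have sd : size y = d.+1 by rewrite /d prednK // (leq_ltn_trans _ y4).
have dN : (d <= N)%N by rewrite -ltnS -sd.
have d4 : (3 < d)%N by rewrite -ltnS -sd.
have yd : y`_d != 0.
  by rewrite -lead_coefE lead_coef_eq0 -size_poly_eq0 sd.
have [g2 [s2 _ H2]] := @diff_op_poly 2 'X^2 (leq_trans (ltnW (ltnW d4)) dN)
  (eq_leq (size_polyXn _ _)).
have [g1 [s1 _ H1]] := @diff_op_poly 1 'X (leq_trans (ltnW (ltnW (ltnW d4))) dN)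
  (eq_leq (size_polyX _)).
have [g [sg gd H]] := @diff_op_poly d y dN (eq_leq sd).
have E : 'X * g2 - 'X^2 * g1 = lam 0%N *: y - g.
  apply: (poly_eq_on_grid z_inj (m := N.+1)) => //.
  - by rewrite (leq_trans (size_XmulB s2 s1)) //; lia.
  - rewrite (leq_trans (size_polyD _ _)) // size_polyN geq_max.
    by rewrite (leq_trans (size_scale_leq _ _)) //= (leq_trans sg).
  move=> s sN; rewrite !hornerE -H // -H1 // -H2 //.
  have := @commutator_identity (fun t => y.[z t]) (fun=> 1) s yE sN.
  have -> : L (fun=> 1) s = lam 0%N by rewrite -(diff_op_1 sN) /L /diff_op !mulr1.
  have e2 t : ('X^2).[z t] = z t ^+ 2 * 1 by rewrite !hornerE.
  have e1 t : ('X).[z t] = z t * 1 by rewrite !hornerE.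
  have e0 t : y.[z t] = y.[z t] * 1 by rewrite mulr1.
  rewrite /L (eq_diff_op _ _ _ _ e2) (eq_diff_op _ _ _ _ e1).
  by rewrite [in X in _ = X -> _]mulrC -[in X in X -> _](eq_diff_op _ _ _ _ e0).
have := congr1 (fun p : {poly F} => p`_d) E.
rewrite (nth_default _ (leq_trans (size_XmulB s2 s1) d4)) coefB coefZ gd -mulrBl.
move=> /esym/eqP; rewrite mulf_eq0 (negPf yd) orbF subr_eq0.
by apply/negP; apply: (bs_spectrum bs) => //; lia.
Qed.

(** The coefficient of degree n + 3 in the commutator identity on x^n; the bound
    on n makes both sides polynomials determined by their values on the grid. *)
Lemma cubic_commutator_lead (y : {poly F}) n : (size y <= 4)%N ->
    (forall t, (t < N)%N ->
       y.[z t.+1] - y.[z t] = z t * z t.+1 * (z t - z t.+1)) ->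
    (n + 3 <= N)%N ->
  lam n.+2 - lam n.+1 = y`_3 * (lam n - lam n.+3).
Proof.
move=> sy yE nN.
have syn : (size (y * 'X^n)%R <= n.+4)%N.
  apply: (leq_trans (size_polyMleq _ _)); rewrite size_polyXn addnS /=.
  by rewrite -addn4 addnC leq_add2l.
have [g [sg cg H]] := @diff_op_poly n 'X^n ltac:(lia) (eq_leq (size_polyXn _ _)).
have [g1 [s1 c1 H1]] := @diff_op_poly n.+1 'X^(n.+1) ltac:(lia)
  (eq_leq (size_polyXn _ _)).
have [g2 [s2 c2 H2]] := @diff_op_poly n.+2 'X^(n.+2) ltac:(lia)
  (eq_leq (size_polyXn _ _)).
have [g3 [s3 c3 H3]] := @diff_op_poly n.+3 (y * 'X^n) ltac:(lia) syn.
have syg : (size (y * g)%R <= n.+4)%N.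
  apply: (leq_trans (size_polyMleq _ _)).
  by rewrite -subn1 leq_subLR (leq_trans (leq_add sy sg)) //; lia.
have E : 'X * g2 - 'X^2 * g1 = y * g - g3.
  apply: (poly_eq_on_grid z_inj (m := N.+1)) => //.
  - by rewrite (leq_trans (size_XmulB s2 s1)) //; lia.
  - rewrite (leq_trans (size_polyD _ _)) // size_polyN geq_max.
    rewrite (leq_trans syg) ?(leq_trans s3) //; lia.
  move=> s sN; rewrite !hornerE -H // -H1 // -H2 // -H3 //.
  have := @commutator_identity (fun t => y.[z t]) (fun t => ('X^n).[z t]) s yE sN.
  have e2 t : ('X^(n.+2)).[z t] = z t ^+ 2 * ('X^n).[z t].
    by rewrite !hornerE !exprS; ring.
  have e1 t : ('X^(n.+1)).[z t] = z t * ('X^n).[z t] by rewrite !hornerE exprS.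
  have e0 t : (y * 'X^n).[z t] = y.[z t] * ('X^n).[z t] by rewrite hornerM.
  by rewrite /L (eq_diff_op _ _ _ _ e2) (eq_diff_op _ _ _ _ e1)
    (eq_diff_op _ _ _ _ e0).
have yg : (y * g)`_n.+3 = y`_3 * g`_n.
  rewrite coefM (bigD1 (inord 3)) //= inordK // big1 ?addr0 ?subSS ?subn0 //.
  move=> i; rewrite -val_eqE /= inordK // => i3.
  have [lt_i|ge_i] := ltnP i 3.
    by rewrite (nth_default _ (leq_trans sg _)) ?mulr0 //; lia.
  by rewrite (nth_default _ (leq_trans sy _)) ?mul0r //; lia.
have := congr1 (fun p : {poly F} => p`_n.+3) E.
rewrite coefB coefXM coefXnM coefB yg /= subSS subSS subn0 cg c1 c2 c3.
rewrite coefMXn !coefXn !eqxx ltnNge leqW ?leqW //= !mulr1.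
have -> : (n.+3 - n = 3)%N by lia.
by move=> ->; rewrite mulrBr; congr (_ - _); rewrite mulrC.
Qed.

(** Up to N = 2 there is at most one equation for the grid and one for the
    spectrum, so any b will do.  Beyond, b + 1 = -1/y_3, where the leading
    coefficient y_3 is nonzero because lam_1 and lam_2 differ. *)
Lemma grid_spectrum_recurrence : exists b g d, forall i, (i.+2 <= N)%N ->
  z i - b * z i.+1 + z i.+2 = g /\ lam i - b * lam i.+1 + lam i.+2 = d.
Proof.
have [N2|N3] := leqP N 2.
  exists 0, (z 0%N - 0 * z 1%N + z 2%N), (lam 0%N - 0 * lam 1%N + lam 2%N).
  by move=> i iN; have -> : i = 0%N by lia.
have [y sy yE] := cubic_commutator.
have lead n nN := @cubic_commutator_lead y n sy yE nN.
have y3 : y`_3 != 0.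
  apply/eqP => y0; have := lead 0%N N3; rewrite y0 mul0r => /eqP.
  by rewrite subr_eq0; apply/negP; apply: (bs_spectrum bs) => //; lia.
pose b := - (y`_3)^-1 - 1.
(* divide the equation of y at t by y_3 (z_(t+1) - z_t) *)
have rel t : (t < N)%N -> z t ^+ 2 + z t.+1 ^+ 2 - b * z t * z t.+1
    + y`_2 / y`_3 * (z t + z t.+1) + y`_1 / y`_3 = 0.
  move=> tN; have := yE t tN; rewrite !(horner_coef_wide _ sy).
  rewrite !big_ord_recl !big_ord0 /= /bump /= => e.
  have nz : y`_3 * (z t.+1 - z t) != 0.
    by rewrite mulf_neq0 // subr_eq0 (bs_grid bs) //; lia.
  apply: (mulIf nz); rewrite mul0r /b; apply: (lincomb 1 e).
  by field.
exists b, (- (y`_2 / y`_3)), (lam 0%N - b * lam 1%N + lam 2%N) => i iN; split.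
  have nz : z i.+2 - z i != 0 by rewrite subr_eq0 (bs_grid bs) //; lia.
  apply: (mulIf nz); apply: (lincomb 1 (rel i.+1 iN)).
  by apply: (lincomb (-1) (rel i (ltnW iN))); ring.
elim: i iN => // i IH iN; rewrite -IH; last exact: ltnW.
have := lead i ltac:(lia) => e.
by apply: (mulfI y3); apply: (lincomb 1 e); rewrite /b; field.
Qed.

(** * The formula for the split sequence *)

(** L on x and x^2, recentred at z_s: together with L 1 = lam_0 these equations
    express the diagonal coefficient B in terms of z and lam. *)
Lemma drift_moments : (2 <= N)%N -> exists p q1 q0, forall s, (s <= N)%N ->
  A s * (z s.+1 - z s) + C s * (z s.-1 - z s) = (lam 1%N - lam 0%N) * z s + p /\
  A s * (z s.+1 - z s) ^+ 2 + C s * (z s.-1 - z s) ^+ 2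
  = (lam 2%N - lam 0%N) * z s ^+ 2 + q1 * z s + q0
    - 2 * z s * ((lam 1%N - lam 0%N) * z s + p).
Proof.
move=> N2.
have [f [sf cf Hf]] := @diff_op_poly 1 'X (ltnW N2) (eq_leq (size_polyX _)).
have [g [sg cg Hg]] := @diff_op_poly 2 'X^2 N2 (eq_leq (size_polyXn _ _)).
exists f`_0, g`_1, g`_0 => s sN.
have fE : f.[z s] = f`_0 + lam 1%N * z s.
  rewrite (horner_coef_wide _ sf) !big_ord_recl big_ord0 /= /bump /= cf coefX.
  by rewrite /=; ring.
have gE : g.[z s] = g`_0 + g`_1 * z s + lam 2%N * z s ^+ 2.
  rewrite (horner_coef_wide _ sg) !big_ord_recl big_ord0 /= /bump /= cg coefXn.
  by rewrite /=; ring.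
have := Hg s sN; have := Hf s sN.
rewrite /L /diff_op !hornerX !hornerXn fE gE => Ef Eg.
have E1 := diff_op_1 sN.
split.
  by apply: (lincomb 1 Ef); apply: (lincomb (- z s) E1); ring.
apply: (lincomb 1 Eg); apply: (lincomb (- 2 * z s) Ef).
by apply: (lincomb (z s ^+ 2) E1); ring.
Qed.

(** The constant C(N) (z_(N-1) - z_N) here and below is the first term of the
    split sequence of the reversed grid. *)
Lemma split_seq_first : (1 <= N)%N -> split_seq 1
  = C N * (z N.-1 - z N) + (lam 1%N - lam 0%N) * (z 0%N - z N).
Proof.
move=> N1; have := diff_op_newton N1 (leqnn N); have := diff_op_1 (leqnn N).
rewrite /L /diff_op !hornerS_newton !newton0 !hornerC (bs_AN bs) => e1 e2.
by apply: (lincomb (-1) e2); apply: (lincomb (z N - z 0%N) e1); ring.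
Qed.

(** The coefficient B(N) read from L 1 and from L on the Newton polynomial of
    degree N. *)
Lemma split_seq_last : (1 <= N)%N -> split_seq N
  = C N * (z N.-1 - z N) + (lam N - lam 0%N) * (z N.-1 - z N).
Proof.
move=> N1.
(* any point other than z_N may follow the grid *)
pose x i := if (i <= N.+1)%N then z i.-1 else z N - 1.
have xz i : (i <= N)%N -> x i.+1 = z i by rewrite /x ltnS => ->.
have := diagonal_coef xz (leqnn N); rewrite split_seq_end xz //.
have -> : x N = z N.-1 by rewrite /x leqnSn.
have -> : x N.+2 = z N - 1 by rewrite /x ltnn.
have := diff_op_1 (leqnn N); rewrite (bs_AN bs) => e1 e2.
by apply: (lincomb (-1) e2); apply: (lincomb (z N - z N.-1) e1); ring.
Qed.

(** The difference D of the two sides satisfies a first-order recurrence with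
    affine right side in z_s, which vanishes at z_0 and z_N. *)
Lemma split_seq_formula i : (1 <= i <= N)%N -> split_seq i
  = C N * (z N.-1 - z N) * vartheta N z i + (lam i - lam 0%N) * (z i.-1 - z N).
Proof.
move=> /andP[i1 iN]; have N1 := leq_trans i1 iN.
have z0N : z 0%N != z N by apply: z_inj => //; lia.
have [N2|N2] := ltnP 1 N; last first.
  have -> : i = 1%N by lia.
  by rewrite vartheta1 // mulr1 split_seq_first.
set K := C N * _.
have [b [g [d recP]]] := grid_spectrum_recurrence.
have [x xP xz'] : exists2 x, recurrent b g x & forall i, (i <= N.+1)%N ->
    x i = if i is j.+1 then z j else g + b * z 0%N - z 1%N.
  apply: recurrent_extension => -[|j] jN; first by ring.
  by have [-> _] := recP j jN.
have xz j : (j <= N)%N -> x j.+1 = z j by move=> jN; rewrite xz'.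
have [l lP ll] := recurrent_extension (fun j jN => (recP j jN).2).
have [k kP] := vartheta_recurrent (fun j jN => (recP j jN).1).
have [t tP tt] := recurrent_extension kP.
have [kt ktP] := cross_difference_const xP tP.
have [kl klP] := cross_difference_const xP lP.
have [p [q1 [q0 mom]]] := drift_moments N2.
have dE : d = lam 0%N - b * lam 1%N + lam 2%N by have [_ <-] := recP 0%N N2.
pose D j := split_seq j - K * t j - (l j - l 0%N) * (x j - z N).
pose d' := d - (2 - b) * l 0%N.
pose e1 := q1 - (lam 1%N - lam 0%N) * g - p * b - K * k
           - (kl + l 0%N * g) + z N * d'.
pose e0 := q0 - p * g - K * kt + z N * (kl + l 0%N * g).
(* with a = x_(s+2) - x_(s+1) and c = x_s - x_(s+1), the product a c (A + C)
   is (A a + C c) (a + c) - (A a^2 + C c^2), so B a c is a quadratic polynomial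
   in z_s; its leading coefficient cancels thanks to the recurrence of lam *)
have DE s : (s <= N)%N ->
    D s * (x s.+1 - x s.+2) + D s.+1 * (x s.+1 - x s) = e1 * z s + e0.
  move=> sN; have [m1 m2] := mom s sN.
  have diag := diagonal_coef xz sN.
  (* off the grid, x and z differ, but A(N) = C(0) = 0 *)
  have Ax : A s * (z s.+1 - x s.+2) = 0.
    move: (sN); rewrite leq_eqVlt => /orP[/eqP->|sN'].
      by rewrite (bs_AN bs) mul0r.
    by rewrite xz // subrr mulr0.
  have Cx : C s * (z s.-1 - x s) = 0.
    case: (s) sN => [|j] jN; first by rewrite (bs_C0 bs) mul0r.
    by rewrite xz ?subrr ?mulr0 // ltnW.
  have E1 := diff_op_1 sN.
  rewrite -(xz s sN) in m1 m2 *; move: (xP s) (ktP s) (klP s) => rx rt rl.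
  have M1 : A s * (x s.+2 - x s.+1) + C s * (x s - x s.+1)
      = (lam 1%N - lam 0%N) * x s.+1 + p.
    by apply: (lincomb 1 m1); apply: (lincomb (-1) Ax); apply: (lincomb (-1) Cx); ring.
  have M2 : A s * (x s.+2 - x s.+1) ^+ 2 + C s * (x s - x s.+1) ^+ 2
      = (lam 2%N - lam 0%N) * x s.+1 ^+ 2 + q1 * x s.+1 + q0
        - 2 * x s.+1 * ((lam 1%N - lam 0%N) * x s.+1 + p).
    apply: (lincomb 1 m2).
    apply: (lincomb (2 * x s.+1 - z s.+1 - x s.+2) Ax).
    by apply: (lincomb (2 * x s.+1 - z s.-1 - x s) Cx); ring.
  rewrite /D /e1 /e0 /d' dE in rl *.
  rewrite (ll 0%N isT) (ll s sN) in rl *.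
  apply: (lincomb (-1) diag); apply: (lincomb (- K) rt).
  apply: (lincomb (- (x s.+1 - z N)) rl).
  apply: (lincomb ((x s.+1 - x s) * (x s.+1 - x s.+2)) E1).
  apply: (lincomb 1 M2); apply: (lincomb (2 * x s.+1 - x s - x s.+2) M1).
  apply: (lincomb (- ((lam 1%N - lam 0%N) * x s.+1 + p)
                   - (x s.+1 - z N) * lam 0%N) rx).
  ring.
have D0 : D 0%N = 0 by rewrite /D tt // vartheta0 /split_seq; ring.
have D1 : D 1%N = 0.
  rewrite /D tt // vartheta1 // split_seq_first // !ll // xz // -/K; ring.
have DN : D N = 0.
  rewrite /D tt // varthetaN // split_seq_last // !ll //.
  have -> : x N = z N.-1 by rewrite -(xz N.-1) ?prednK // leq_pred.
  by rewrite -/K; ring.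
have DN1 : D N.+1 = 0.
  by rewrite /D tt // vartheta_end split_seq_end xz //; ring.
have e1_0 : e1 = 0.
  have := DE 0%N isT; rewrite D0 D1 => z0.
  have := DE N (leqnn N); rewrite DN DN1 => zN.
  have nz : z 0%N - z N != 0 by rewrite subr_eq0.
  by apply: (mulIf nz); apply: (lincomb (-1) z0); apply: (lincomb 1 zN); ring.
have e0_0 : e0 = 0.
  have := DE 0%N isT; rewrite D0 D1 e1_0 => z0.
  by apply: (lincomb (-1) z0); ring.
have D_0 j : (j <= N)%N -> D j = 0.
  elim: j => [|j IH] jN; first exact: D0.
  case: j IH jN => [|j] IH jN; first exact: D1.
  have nz : x j.+2 - x j.+1 != 0.
    by rewrite !xz ?(ltnW jN) ?(ltnW (ltnW jN)) // subr_eq0 z_inj //; lia.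
  have := DE j.+1 (ltnW jN); rewrite IH ?(ltnW jN) // e1_0 e0_0 => e.
  by apply: (mulIf nz); apply: (lincomb 1 e); ring.
have := D_0 i iN; rewrite /D tt ?ll //; last lia.
have -> : x i = z i.-1 by rewrite -(xz i.-1) ?prednK // ; lia.
by move=> e; apply: (lincomb 1 e); ring.
Qed.

End Bispectral.

(** * Reversal of the grid and conclusion *)

Lemma bispectral_rev (F : fieldType) N (z A B C lam : nat -> F) P :
    bispectral N z A B C lam P ->
  bispectral N (fun s => z (N - s)%N) (fun s => C (N - s)%N)
    (fun s => B (N - s)%N) (fun s => A (N - s)%N) lam P.
Proof.
move=> bs; have [C0 AN A0 Cn0 mP eigP zi li] := bs; split=> //.
- by rewrite subn0.
- by rewrite subnn.
- by move=> s sN; rewrite -(prednK (_ : 0 < N - s)%N) ?subn_gt0 // Cn0 //; lia.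
- by move=> s sN; apply: A0; lia.
- move=> n s nN sN; rewrite -eigP // ?leq_subr // /diff_op.
  have -> : A (N - s)%N * (P n).[z (N - s.-1)%N] = A (N - s)%N * (P n).[z (N - s).+1].
    case: s sN => [|s] sN; first by rewrite subn0 AN !mul0r.
    by congr (_ * _.[z _]); lia.
  rewrite subnS; ring.
- move=> i j iN jN ij; apply: zi; rewrite ?leq_subr //; lia.
Qed.

Lemma bispectral_finite_askey_wilson (F : fieldType) N (z A B C lam : nat -> F) P :
  bispectral N z A B C lam P -> finite_askey_wilson N z lam P.
Proof.
move=> bs; have bs' := bispectral_rev bs.
split; first exact: (bs_monic bs).
  by move=> n; apply: (monic_value_neq0 bs).
exists (split_seq z A), (split_seq (fun s => z (N - s)%N) (fun s => C (N - s)%N)).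
split; last by move=> n; apply: (series_expansion bs).
have first_split (u D : nat -> F) : split_seq u D 1 = D 0%N * (u 1%N - u 0%N).
  by rewrite /split_seq hornerS_newton newton0 !hornerC divr1 mul1r.
split.
- exact: (split_seq_neq0 bs).
- exact: (split_seq_neq0 bs').
- exact: bs_grid bs.
- exact: bs_spectrum bs.
- by move=> i iN; rewrite (split_seq_formula bs iN) first_split /= !subn0 !subn1.
- move=> i iN; rewrite (split_seq_formula bs' iN) first_split /= !subnn.
  have [i1 iN'] := andP iN.
  rewrite vartheta_rev //.
  by congr (_ * (z _ - _) * _ + _ * (z _ - _)); lia.
have [b [g [d rec]]] := grid_spectrum_recurrence bs.
have ratio u e i : (forall j, (j.+2 <= N)%N -> u j - b * u j.+1 + u j.+2 = e) ->
    pairwise_distinct N u -> (2 <= i <= N - 1)%N -> step_ratio u i = b + 1.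
  case: i => [|[|i]] uP ui iN; [lia|lia|].
  have nz : u i.+1 - u i.+2 != 0 by rewrite subr_eq0 ui //; lia.
  rewrite /step_ratio !subSS !subn0; apply: (canLR (mulfK nz)).
  have := uP i ltac:(lia); have := uP i.+1 ltac:(lia) => e1 e0.
  by apply: (lincomb 1 e0); apply: (lincomb (-1) e1); ring.
exists (b + 1) => i iN; split.
- by apply: ratio (bs_grid bs) iN => j jN; case: (rec j jN) => h _; exact: h.
- by apply: ratio (bs_spectrum bs) iN => j jN; case: (rec j jN) => _ h; exact: h.
Qed.

Theorem theorem1 (R : realType) (N : nat) (hN : (1 <= N)%N)
  (z A B C lambda : nat -> R[i]) (P : nat -> {poly R[i]})
  (hC0 : C 0%N = 0) (hAN : A N = 0)
  (hP : monic_family N P)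
  (heq : forall n s : nat, (n <= N)%N -> (s <= N)%N ->
     (if (s < N)%N then A s * (P n).[z (s + 1)%N] else 0)
     + B s * (P n).[z s]
     + (if (0 < s)%N then C s * (P n).[z (s - 1)%N] else 0)
     = lambda n * (P n).[z s])
  (hAC : forall s : nat, (1 <= s <= N)%N -> A (s - 1)%N * C s != 0)
  (hz : pairwise_distinct N z)
  (hlambda : pairwise_distinct N lambda) :
  finite_askey_wilson N z lambda P.
Proof.
apply: (@bispectral_finite_askey_wilson _ N z A B C); split=> //.
- move=> s sN; have := hAC s.+1 sN; rewrite subn1 mulf_eq0.
  by case/norP.
- by move=> s sN; have := hAC s.+1 sN; rewrite mulf_eq0; case/norP.
move=> n s nN sN; rewrite -heq // /diff_op addn1 subn1; congr (_ + _ + _).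
  2: by case: (s) => //; rewrite hC0 mul0r.
by move: sN; rewrite leq_eqVlt => /orP[/eqP->|->]; rewrite ?ltnn ?hAN ?mul0r.
Qed.
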